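(* Let $\tau$ be a Hausdorff shift-continuous topology on the semigroup $\mathscr{C}_{\mathbb{Z}}^{0,0}$. Then each of the inequalities $a>0$ or $b>0$ implies that $(a,b)$ is an isolated point of $(\mathscr{C}_{\mathbb{Z}}^{0,0},\tau)$.
   Context: The extended bicyclic semigroup $\mathscr{C}_{\mathbb{Z}}$ is the set $\mathbb{Z}\times\mathbb{Z}$ with the associative operation $(a,b)\cdot(c,d)=(a-b+c,d)$ if $b<c$; $(a,d)$ if $b=c$; $(a,d+b-c)$ if $b>c$. The variant $\mathscr{C}_{\mathbb{Z}}^{0,0}$ is the set $\mathbb{Z}\times\mathbb{Z}$ with the semigroup operation $(a,b)\ast_{0,0}(c,d)=(a,b)\cdot(0,0)\cdot(c,d)$. A topology on a semigroup is shift-continuous if the semigroup operation is separately continuous, i.e. all left and right translations are continuous. *)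

(* Defs.v *)
From HB Require Import structures.
From mathcomp Require Import all_boot all_order all_algebra zify.
From mathcomp Require Import all_classical all_analysis.

Set Implicit Arguments.
Unset Strict Implicit.
Unset Printing Implicit Defensive.

Import Order.TTheory GRing.Theory Num.Theory.

Local Open Scope ring_scope.
Local Open Scope classical_set_scope.

(* The carriers are aliases, so that each bears its own semigroup structure. *)
Definition ext_bicyclic : Type := (int * int)%type.

HB.instance Definition _ := Choice.on ext_bicyclic.

Definition ext_bicyclic_mul (x y : ext_bicyclic) : ext_bicyclic :=
  let: (a, b) := x in
  let: (c, d) := y in
  if b < c then (a - b + c, d)
  else if b == c then (a, d)
  else (a, d + b - c).

Lemma ext_bicyclic_mulA : associative ext_bicyclic_mul.
Proof.
move=> [a b] [c d] [e f]; rewrite /ext_bicyclic_mul.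
by do ![case: ifP => ?]; congr pair; lia.
Qed.

HB.instance Definition _ :=
  isSemigroup.Build ext_bicyclic ext_bicyclic_mulA.

Definition variant (S : semigroupType) (s : S) : Type := S.

Section Variant.
Variables (S : semigroupType) (s : S).

HB.instance Definition _ := Choice.on (variant s).

Definition variant_mul (x y : variant s) : variant s :=
  ((x : S) * s * (y : S))%g.

Lemma variant_mulA : associative variant_mul.
Proof. by move=> x y z; rewrite /variant_mul !mulgA. Qed.

HB.instance Definition _ := isSemigroup.Build (variant s) variant_mulA.

End Variant.

Definition CZ00 : semigroupType := variant ((0, 0) : ext_bicyclic).

(* The topology is quantified over as a structure on a fixed carrier, because
   [int * int] already has a canonical topology, which is not the one meant. *)
Definition topology (X : Type) : Type := Topological.axioms_ X.

Definition topspace (X : Type) (tau : topology X) : topologicalType :=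
  Topological.Pack tau.

Definition shift_continuous (S : semigroupType) (tau : topology S) : Prop :=
  (forall s : S, continuous ((fun x : S => (s * x)%g) : topspace tau -> topspace tau))
  /\
  (forall s : S, continuous ((fun x : S => (x * s)%g) : topspace tau -> topspace tau)).

(* Main.v *)
(* In a Hausdorff shift-continuous topology the set where two translations
   differ is open; with s = (n, n), n >= 0, this makes the half-planes
   {c < n} and {d < n} open, since (n, n) * (c, d) = (c, d) iff n <= c.
   The preimage of a quadrant under a two-sided translation is the part of a
   diagonal {c - d = const} lying below some point, which is therefore open.
   If a > 0, intersect such a ray through (a, b) with {c < a + 1} and remove
   the closed subray {x | (a-1, a-1) * x = (a-1, b-1)} = {.., (a-1, b-1)} to
   be left with (a, b) alone; the case b > 0 is symmetric. *)
Require Import Defs.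
From mathcomp Require Import all_boot all_order all_algebra zify.
From mathcomp Require Import all_classical all_analysis.

Import Order.TTheory GRing.Theory Num.Theory.

Local Open Scope ring_scope.
Local Open Scope classical_set_scope.

(** In [ext_bicyclic] the product of (a, b) and (c, d) is (a - b + m, d - c + m) with m = max(b, c);
    the middle factor (0, 0) only adds 0 to that maximum. *)
Lemma CZ00_mulE (a b c d : int) :
  (((a, b) : CZ00) * ((c, d) : CZ00))%g =
  ((a - b + Num.max 0 (Num.max b c), d - c + Num.max 0 (Num.max b c)) : CZ00).
Proof.
change (ext_bicyclic_mul (ext_bicyclic_mul (a, b) (0, 0)) (c, d) =
  (a - b + Num.max 0 (Num.max b c), d - c + Num.max 0 (Num.max b c))).
rewrite /ext_bicyclic_mul.
by do ![case: ifP => ?]; congr pair; lia.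
Qed.

Lemma open_neq_fun (X Y : topologicalType) (f g : X -> Y) :
  hausdorff_space Y -> continuous f -> continuous g ->
  open [set x | f x <> g x].
Proof.
move=> hY cf cg; rewrite openE => x /= /eqP fgx.
move: hY; rewrite open_hausdorff => /(_ _ _ fgx)[[U V] /= [Ux Vx] [oU oV UV]].
have Ufx : nbhs (f x) U by apply: open_nbhs_nbhs; split => //; apply: set_mem.
have Vgx : nbhs (g x) V by apply: open_nbhs_nbhs; split => //; apply: set_mem.
have fU : nbhs x (f @^-1` U) by exact: cf.
have gV : nbhs x (g @^-1` V) by exact: cg.
apply: filterS2 fU gV => y Uy Vy fgy.
have : (U `&` V) (f y) by split=> //; rewrite fgy.
by rewrite (eqP UV).
Qed.

Lemma isolated_of_open (T : topologicalType) (U : set T) (x : T) :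
  open U -> U = [set x] -> isolated [set: T] x.
Proof.
move=> oU Ux; split; rewrite ?inE//.
exists U; last by rewrite setIT.
by apply: open_nbhs_nbhs; split; rewrite // Ux.
Qed.

Section CZ00_topology.
Variable tau : topology CZ00.
Hypothesis tau_hausdorff : hausdorff_space (topspace tau).
Hypothesis tau_shift : shift_continuous tau.

Lemma open_fst_lt (n : int) : 0 <= n ->
  open ([set x : int * int | x.1 < n] : set (topspace tau)).
Proof.
move=> n0.
have -> : [set x : int * int | x.1 < n] =
    [set x : CZ00 | (((n, n) : CZ00) * x)%g <> x].
  apply/seteqP; split=> -[c d] /=; rewrite CZ00_mulE.
    by move=> ? [? ?]; lia.
  by move=> h; rewrite ltNge; apply/negP => ?; apply: h; congr pair; lia.
apply: (@open_neq_fun (topspace tau) (topspace tau)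
    (fun x : CZ00 => (((n, n) : CZ00) * x)%g) id) => //.
  exact: tau_shift.1.
by move=> ?; exact: cvg_id.
Qed.

Lemma open_snd_lt (n : int) : 0 <= n ->
  open ([set x : int * int | x.2 < n] : set (topspace tau)).
Proof.
move=> n0.
have -> : [set x : int * int | x.2 < n] =
    [set x : CZ00 | (x * ((n, n) : CZ00))%g <> x].
  apply/seteqP; split=> -[c d] /=; rewrite CZ00_mulE.
    by move=> ? [? ?]; lia.
  by move=> h; rewrite ltNge; apply/negP => ?; apply: h; congr pair; lia.
apply: (@open_neq_fun (topspace tau) (topspace tau)
    (fun x : CZ00 => (x * ((n, n) : CZ00))%g) id) => //.
  exact: tau_shift.2.
by move=> ?; exact: cvg_id.
Qed.

(* The ray is the preimage, under x |-> (0, p) * x * (q, 0), of the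
   quadrant of points with no positive coordinate. *)
Lemma open_diagonal_ray (p q : int) : 0 <= p -> 0 <= q ->
  open ([set x : int * int | [/\ x.1 <= p, x.2 <= q & x.1 - x.2 = p - q]]
        : set (topspace tau)).
Proof.
move=> p0 q0.
pose g (x : topspace tau) : topspace tau :=
  (((0, p) : CZ00) * (x : CZ00) * ((q, 0) : CZ00))%g.
have -> : [set x : int * int | [/\ x.1 <= p, x.2 <= q & x.1 - x.2 = p - q]] =
    g @^-1` ([set x : int * int | x.1 < 1] `&` [set x : int * int | x.2 < 1]).
  apply/seteqP; split=> -[c d] /=; rewrite /g !CZ00_mulE /=.
    by move=> [? ? ?]; split; lia.
  (* A second coordinate at most 0 forces d <= q and c - d >= p - q; the first one then forces c - d
     <= p - q. *)
  by move=> [? ?]; split; lia.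
apply: open_comp => [x _|]; last first.
  by apply: openI; [apply: open_fst_lt|apply: open_snd_lt].
exact: (@continuous_comp (topspace tau) (topspace tau) (topspace tau)
  (fun x : CZ00 => (((0, p) : CZ00) * x)%g)
  (fun x : CZ00 => (x * ((q, 0) : CZ00))%g) x
  (tau_shift.1 _ _) (tau_shift.2 _ _)).
Qed.

Lemma isolated_fst_gt0 (a b : int) : 0 < a ->
  isolated [set: topspace tau] ((a, b) : topspace tau).
Proof.
(* (p, q) is (a, b) raised along its diagonal by max(0, -b), the least shift making both coordinates
   non-negative, as [open_diagonal_ray] requires. *)
move=> a0; pose p := Num.max a (a - b); pose q := Num.max b 0.
apply: (@isolated_of_open (topspace tau)
  ([set x : int * int | [/\ x.1 <= p, x.2 <= q & x.1 - x.2 = p - q]] `&`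
   [set x : int * int | x.1 < a + 1] `&`
   [set x : CZ00 | (((a - 1, a - 1) : CZ00) * x)%g <> (a - 1, b - 1)])).
  apply: openI; first apply: openI.
  - by apply: open_diagonal_ray; lia.
  - by apply: open_fst_lt; lia.
  - apply: (@open_neq_fun (topspace tau) (topspace tau)
    (fun x : CZ00 => (((a - 1, a - 1) : CZ00) * x)%g) (fun=> (a - 1, b - 1))) => //; first exact: tau_shift.1.
    by move=> ?; exact: cvg_cst.
apply/seteqP; split=> -[c d] /=; rewrite CZ00_mulE; last first.
  by move=> [-> ->]; split; [split; [split|]|case]; lia.
move=> [[[? ? ?] ?] h].
have [?|?] := lerP a c; first by congr pair; lia.
(* As a - 1 >= 0, the translation lifts a point with c <= a - 1 along its diagonal to first
   coordinate a - 1, hence to (a - 1, b - 1). *)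
by case: h; congr pair; lia.
Qed.

Lemma isolated_snd_gt0 (a b : int) : 0 < b ->
  isolated [set: topspace tau] ((a, b) : topspace tau).
Proof.
(* Here the shift along the diagonal is max(0, -a), since only a can be negative. *)
move=> b0; pose p := Num.max a 0; pose q := Num.max b (b - a).
apply: (@isolated_of_open (topspace tau)
  ([set x : int * int | [/\ x.1 <= p, x.2 <= q & x.1 - x.2 = p - q]] `&`
   [set x : int * int | x.2 < b + 1] `&`
   [set x : CZ00 | (x * ((b - 1, b - 1) : CZ00))%g <> (a - 1, b - 1)])).
  apply: openI; first apply: openI.
  - by apply: open_diagonal_ray; lia.
  - by apply: open_snd_lt; lia.
  - apply: (@open_neq_fun (topspace tau) (topspace tau)
    (fun x : CZ00 => (x * ((b - 1, b - 1) : CZ00))%g) (fun=> (a - 1, b - 1))) => //; first exact: tau_shift.2.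
    by move=> ?; exact: cvg_cst.
apply/seteqP; split=> -[c d] /=; rewrite CZ00_mulE; last first.
  by move=> [-> ->]; split; [split; [split|]|case]; lia.
move=> [[[? ? ?] ?] h].
have [?|?] := lerP b d; first by congr pair; lia.
by case: h; congr pair; lia.
Qed.

End CZ00_topology.

Theorem theorem3p5 (tau : topology CZ00)
    (tau_hausdorff : hausdorff_space (topspace tau))
    (tau_shift : shift_continuous tau)
    (a b : int) (ab_gt0 : 0 < a \/ 0 < b) :
  isolated [set: topspace tau] ((a, b) : topspace tau).
Proof.
by case: ab_gt0 => ?; [apply: isolated_fst_gt0|apply: isolated_snd_gt0].
Qed.
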